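(* For every $n\ge1$, there is a bijection between the intervals of $\mathbb{F}_n^\infty$ and the bicolored Motzkin paths of length $n-1$.
   Context: A Dyck path of semilength $n\ge 0$ is a lattice path from $(0,0)$ to $(2n,0)$ with steps $U=(1,1)$ and $D=(1,-1)$ that never goes below the $x$-axis; it is identified with its word over $\{U,D\}$. A path avoids a pattern $\alpha$ if $\alpha$ does not occur as a factor (block of consecutive steps). $\mathcal{F}_n^\infty$ is the set of Dyck paths of semilength $n$ avoiding $DUU$, ordered by the Stanley order: $P\le Q$ iff $P$ lies weakly below $Q$ when both are drawn in the plane; $\mathbb{F}_n^\infty=(\mathcal{F}_n^\infty,\le)$. An interval is a set $[P,Q]=\{R:P\le R\le Q\}$ with $P\le Q$ (equivalently, a pair $(P,Q)$ with $P\le Q$). A bicolored Motzkin path of length $m$ is a lattice path in the quarter plane $\{y\ge0\}$ starting at $(0,0)$, consisting of $m$ steps, each of which is one of $U=(1,1)$, $D=(1,-1)$, $F_1=(1,0)$, $F_2=(1,0)$ (two distinguishable kinds of flat steps); its endpoint height is arbitrary. *)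

(* Defs.v *)
From HB Require Import structures.
From mathcomp Require Import all_boot all_order all_algebra.

Set Implicit Arguments.
Unset Strict Implicit.
Unset Printing Implicit Defensive.

Import Order.TTheory GRing.Theory Num.Theory.
Local Open Scope ring_scope.

(* A lattice path starting at the origin is the word of its steps. All steps
   used here advance the abscissa by 1, so only their vertical displacement
   is recorded: the path [w] passes through [(i, height rise (take i w))]. *)

Definition height (T : Type) (rise : T -> int) (w : seq T) : int :=
  \sum_(s <- w) rise s.

Definition nonneg_path (T : Type) (rise : T -> int) (w : seq T) : bool :=
  [forall i : 'I_(size w).+1, 0 <= height rise (take i w)].

Inductive dstep := U | D.

Definition bool_of_dstep (s : dstep) : bool := if s is U then true else false.
Definition dstep_of_bool (b : bool) : dstep := if b then U else D.
Lemma bool_of_dstepK : cancel bool_of_dstep dstep_of_bool.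
Proof. by case. Qed.
HB.instance Definition _ := Finite.copy dstep (can_type bool_of_dstepK).

Definition drise (s : dstep) : int := match s with U => 1 | D => -1 end.

Definition is_dyck (w : seq dstep) : bool :=
  nonneg_path drise w && (height drise w == 0).

Definition avoids (alpha w : seq dstep) : bool := ~~ infix alpha w.

Record Finf (n : nat) := MkFinf {
  Finf_word :> (n.*2).-tuple dstep;
  _ : is_dyck Finf_word && avoids [:: D; U; U] Finf_word
}.

HB.instance Definition _ (n : nat) := [isSub for @Finf_word n].
HB.instance Definition _ (n : nat) := [Finite of Finf n by <:].

(* Paths are linear between consecutive integer abscissas, so comparing the
   heights there is comparing the drawn paths. *)
Definition stanley_le (n : nat) (P Q : Finf n) : bool :=
  [forall i : 'I_(n.*2).+1,
     height drise (take i P) <= height drise (take i Q)].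

Lemma stanley_le_refl (n : nat) : reflexive (@stanley_le n).
Proof. by move=> P; apply/forallP. Qed.

Lemma stanley_le_trans (n : nat) : transitive (@stanley_le n).
Proof.
move=> Q P R /forallP PQ /forallP QR; apply/forallP => i.
exact: le_trans (PQ i) (QR i).
Qed.

Lemma drise_inj : injective drise.
Proof. by case; case. Qed.

Lemma stanley_le_anti (n : nat) : antisymmetric (@stanley_le n).
Proof.
move=> P Q /andP[/forallP PQ /forallP QP]; apply/val_inj/val_inj => /=.
have E (i : nat) : (i <= n.*2)%N ->
    height drise (take i P) = height drise (take i Q).
  move=> ile; apply/eqP; rewrite eq_le.
  by rewrite (PQ (Ordinal (ile : (i < n.*2.+1)%N)))
             (QP (Ordinal (ile : (i < n.*2.+1)%N))).
apply: (@eq_from_nth _ U); rewrite ?size_tuple // => i ilt.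
have := E i.+1 ilt; have := E i (ltnW ilt).
rewrite !(take_nth U) ?size_tuple // /height -!cats1 !big_cat !big_seq1 /=.
by move=> -> /addrI /drise_inj.
Qed.

HB.instance Definition _ (n : nat) :=
  Order.Le_isPOrder.Build (Order.Disp tt tt) (Finf n)
    (@stanley_le_refl n) (@stanley_le_anti n) (@stanley_le_trans n).

Definition closed_interval (n : nat) (P Q : Finf n) : {set Finf n} :=
  [set R | (P <= R)%O && (R <= Q)%O].

Definition is_interval (n : nat) (I : {set Finf n}) : bool :=
  [exists P : Finf n, exists Q : Finf n,
     (P <= Q)%O && (I == closed_interval P Q)].

Definition interval_of_Finf (n : nat) := {I : {set Finf n} | is_interval I}.

Inductive mstep := MU | MD | MF1 | MF2.

Definition bools_of_mstep (s : mstep) : bool * bool :=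
  match s with
  | MU => (true, true) | MD => (true, false)
  | MF1 => (false, true) | MF2 => (false, false)
  end.
Definition mstep_of_bools (b : bool * bool) : mstep :=
  match b with
  | (true, true) => MU | (true, false) => MD
  | (false, true) => MF1 | (false, false) => MF2
  end.
Lemma bools_of_mstepK : cancel bools_of_mstep mstep_of_bools.
Proof. by case. Qed.
HB.instance Definition _ := Finite.copy mstep (can_type bools_of_mstepK).

Definition mrise (s : mstep) : int :=
  match s with MU => 1 | MD => -1 | MF1 | MF2 => 0 end.

Definition bicolored_motzkin (m : nat) :=
  {w : m.-tuple mstep | nonneg_path mrise w}.

(* Main.v *)
Require Import Defs.
From mathcomp Require Import all_boot.
From mathcomp Require Import all_order all_algebra zify.

(** After its first descent step, a [DUU]-avoiding Dyck path is a product of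
    [n-1] factors, each [D] or [UD], and these factors are arbitrary: the
    length of the initial ascent is forced, and the path then never goes below
    the axis. So the path is a binary word [c] of length [n-1]. Since exactly
    [n - #UD(drop j c)] up steps precede the down step of index [j] (from 0),
    [P <= Q] means that every suffix of the word of [P] contains at least as
    many factors [UD] as the suffix of the same length of the word of [Q].
    Reading both words backwards, letter by letter, a pair [P <= Q] is thus a
    bicolored Motzkin path. *)

Set Implicit Arguments.
Unset Strict Implicit.
Unset Printing Implicit Defensive.

Import Order.TTheory GRing.Theory Num.Theory.

(** * Heights as counts of down steps *)

Lemma height_cons (T : Type) (rise : T -> int) (s : T) (w : seq T) :
  height rise (s :: w) = (rise s + height rise w)%R.
Proof. by rewrite /height big_cons. Qed.

Lemma height_drise (w : seq dstep) :
  height drise w = ((size w)%:Z - (2 * count_mem D w)%:Z)%R.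
Proof.
elim: w => [|s w IHw]; first by rewrite /height big_nil.
by rewrite height_cons IHw; case: s => /=; lia.
Qed.

Lemma count_UD (w : seq dstep) : count_mem U w + count_mem D w = size w.
Proof. by elim: w => //= -[] w <- /=; lia. Qed.

(** * The path of a binary word *)

Fixpoint descent_word (c : seq bool) : seq dstep :=
  match c with
  | [::] => [::]
  | true :: c' => [:: U, D & descent_word c']
  | false :: c' => D :: descent_word c'
  end.

Definition path_word (c : seq bool) : seq dstep :=
  nseq ((size c).+1 - count id c) U ++ D :: descent_word c.

Lemma count_D_descent (c : seq bool) : count_mem D (descent_word c) = size c.
Proof. by elim: c => //= -[] c /= ->. Qed.

Lemma count_U_descent (c : seq bool) :
  count_mem U (descent_word c) = count id c.
Proof. by elim: c => //= -[] c /= ->. Qed.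

Lemma count_D_path (c : seq bool) : count_mem D (path_word c) = (size c).+1.
Proof. by rewrite /path_word count_cat count_nseq /= count_D_descent. Qed.

Lemma size_path_word (c : seq bool) : size (path_word c) = (size c).+1.*2.
Proof.
rewrite -count_UD count_D_path /path_word count_cat count_nseq /=.
rewrite count_U_descent; have := count_size id c; lia.
Qed.

(** The [D] of index [j] is preceded by [j] other [D]s and by one [U] for each [true] among the
    first [j] letters; this is its position. *)
Lemma ltn_count_D_descent (c : seq bool) (i j : nat) : j <= size c ->
  (j < count_mem D (take i (D :: descent_word c)))
    = (count id (take j c) + j < i).
Proof.
elim: c i j => [|b c /= IHc] i j.
  by rewrite leqn0 => /eqP ->; case: i.
case: j => [_|j]; first by case: i.
move=> le_jc; case: i => [|i] /=; first by lia.
case: b => /=; last by have := IHc i j le_jc; lia.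
by case: i => [|i] /=; [lia | have := IHc i j le_jc; lia].
Qed.

(** The initial ascent shifts positions by [(size c).+1 - count id c], which turns the count on
    [take j c] into minus the count on [drop j c]; the additive form avoids truncated
    subtraction. *)
Lemma ltn_count_D_path (c : seq bool) (i j : nat) : j <= size c ->
  (j < count_mem D (take i (path_word c)))
    = ((size c).+1 + j < i + count id (drop j c)).
Proof.
move=> le_jc; rewrite /path_word take_cat size_nseq.
have := count_size id c; rewrite -[in count id c](cat_take_drop j c) count_cat.
case: (ltnP i (_ - _)) => lt_i le_c.
  rewrite take_nseq ?count_nseq /=; last exact: ltnW.
  by lia.
rewrite count_cat count_nseq /= add0n ltn_count_D_descent //.
by lia.
Qed.

Lemma dyck_path_word (c : seq bool) : is_dyck (path_word c).
Proof.
apply/andP; split; last first.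
  by rewrite height_drise size_path_word count_D_path; lia.
apply/forallP => i; rewrite height_drise size_takel; last by rewrite -ltnS.
case E: (count_mem D _) => [|j]; first by lia.
have le_j : j <= size c.
  by rewrite -ltnS -E -count_D_path leq_count_subseq // take_subseq.
(* The last of the [j.+1] down steps seen has index [j]; as [drop j c] has at most [size c - j]
   letters, [i] is at least [2 * j.+1]. *)
have := ltn_count_D_path i le_j; rewrite E ltnSn.
by have := count_size id (drop j c); rewrite size_drop; lia.
Qed.

Lemma avoids_path_word (c : seq bool) : avoids [:: D; U; U] (path_word c).
Proof.
rewrite /avoids /path_word; elim: (_ - _) => [|a IHa] //=.
by elim: c => [|[] c IHc] //=; case: c IHc => [|[] c] //=.
Qed.

(** * Recovering the binary word from the path *)

Lemma descent_word_inj : injective descent_word.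
Proof.
by elim=> [|[] c IHc] [|[] d] //= [] /IHc ->.
Qed.

Lemma path_word_inj : injective path_word.
Proof.
move=> c d; rewrite /path_word; elim: (_ - _) (_ - _) => [|a IHa] [|b] //=.
  by case=> /descent_word_inj.
by case=> /IHa.
Qed.

(** The [D] put in front of [r] is the down step just read: after it, a [U] can be followed neither
    by [U], which would make [DUU], nor by the end of the word. The induction is on the size since a
    factor [UD] uses two letters. *)
Lemma descent_word_surj (r : seq dstep) :
    avoids [:: D; U; U] (D :: r) -> last D r = D ->
  exists c, r = descent_word c.
Proof.
have [k] := ubnP (size r); elim: k r => // k IHk [|[] r] /= lt_r av la.
- by exists [::].
- case: r => [|[] r] //= in lt_r av la *.
    by case: r av {lt_r la}.
  have [|c ->] := IHk r _ av la; first by lia.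
  by exists (true :: c).
- have [|c ->] := IHk r _ av la; first by lia.
  by exists (false :: c).
Qed.

Lemma split_first_D (w : seq dstep) : D \in w ->
  exists a r, w = nseq a U ++ D :: r.
Proof.
elim: w => //= -[] w IHw; last by exists 0, w.
by rewrite inE => /IHw[a [r ->]]; exists a.+1, r.
Qed.

(** A final [U] ending at height 0 would start at height -1. The default [D] covers the empty
    word. *)
Lemma last_dyck (w : seq dstep) : is_dyck w -> last D w = D.
Proof.
case: (lastP w) => // {}w []; last by rewrite last_rcons.
case/andP=> /forallP pos /eqP; rewrite -cats1 /height big_cat big_seq1 /= => h0.
have lt_w : size w < (size (rcons w U)).+1 by rewrite size_rcons; lia.
have := pos (Ordinal lt_w); rewrite /= -cats1 take_size_cat // /height.
by move/eqP: h0; rewrite addr_eq0 => /eqP ->.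
Qed.

Lemma avoids_catr (alpha u w : seq dstep) :
  avoids alpha (u ++ w) -> avoids alpha w.
Proof. by apply: contraNN => aw; apply: infix_catl. Qed.

Lemma path_word_surj (w : seq dstep) :
    is_dyck w -> avoids [:: D; U; U] w -> 0 < size w ->
  exists2 c, w = path_word c & size w = (size c).+1.*2.
Proof.
move=> dw av w_gt0; have /andP[_ /eqP] := dw; rewrite height_drise => hw.
have /split_first_D[a [r Ew]] : D \in w by rewrite -has_pred1 has_count; lia.
have [||c Er] := @descent_word_surj r.
- by move: av; rewrite Ew; apply: avoids_catr.
- by move: (last_dyck dw); rewrite Ew last_cat.
(* Equally many [U] and [D] force the length [a] of the initial ascent. *)
have cU := count_UD w; have cD : count_mem D w = (size c).+1.
  by rewrite Ew Er count_cat count_nseq /= count_D_descent.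
have : count_mem U w = a + count id c.
  by rewrite Ew Er count_cat count_nseq /= count_U_descent; lia.
exists c; last by lia.
by rewrite Ew Er /path_word; congr (nseq _ _ ++ _); lia.
Qed.

(** * The Stanley order on binary words *)

Section FinfOfWord.
Variable m : nat.
Implicit Types (c d : m.-tuple bool) (P Q : Finf m.+1).

Lemma path_word_sizeP c : size (path_word c) == m.+1.*2.
Proof. by rewrite size_path_word size_tuple. Qed.

Lemma path_word_FinfP c :
  is_dyck (Tuple (path_word_sizeP c)) &&
    avoids [:: D; U; U] (Tuple (path_word_sizeP c)).
Proof. by rewrite dyck_path_word avoids_path_word. Qed.

Definition Finf_of_word c : Finf m.+1 := MkFinf (path_word_FinfP c).

Lemma Finf_of_word_inj : injective Finf_of_word.
Proof.
move=> c d E; apply/val_inj/path_word_inj.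
exact: (congr1 (fun P => val (Finf_word P)) E).
Qed.

Lemma Finf_of_word_surj P : exists c, P = Finf_of_word c.
Proof.
have /andP[dP aP] := valP P.
have [|c Ew Es] := path_word_surj dP aP; first by rewrite size_tuple.
have sz_c : size c == m.
  by move: Es; rewrite size_tuple => /double_inj[->].
by exists (Tuple sz_c); apply/val_inj/val_inj.
Qed.

(** At equal abscissas, lower means more down steps so far; hence each down step of the lower path
    must come no later than the one of the same index in the upper path. *)
Lemma le_Finf_of_word c d :
  reflect (forall j, j <= m -> count id (drop j d) <= count id (drop j c))
          (Finf_of_word c <= Finf_of_word d)%O.
Proof.
have ltD (e : m.-tuple bool) i j : j <= m ->
    (j < count_mem D (take i (path_word e)))
      = (m.+1 + j < i + count id (drop j e)).
  by move=> le_jm; rewrite ltn_count_D_path size_tuple.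
have leE i : i <= m.+1.*2 ->
    (height drise (take i (path_word c))
       <= height drise (take i (path_word d)))%R
    = (count_mem D (take i (path_word d))
         <= count_mem D (take i (path_word c))).
  move=> le_i; rewrite !height_drise !size_takel ?size_path_word ?size_tuple //.
  by lia.
have le_drop (e : m.-tuple bool) j : j <= m -> count id (drop j e) <= m - j.
  by have := count_size id (drop j e); rewrite size_drop size_tuple.
apply: (iffP forallP) => [le_cd j le_jm | le_dc [i lt_i] /=].
  (* The abscissa just after the down step of index [j] in the upper path; [bound] ensures that the
     subtraction does not truncate. *)
  pose i := (m.+1 + j - count id (drop j d)).+1.
  have := le_drop d j le_jm => bound.
  have lt_i : i < m.+1.*2.+1 by lia.
  have leD : count_mem D (take i (path_word d))
               <= count_mem D (take i (path_word c)).
    by rewrite -leE //; apply: (le_cd (Ordinal lt_i)).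
  move: leD (ltD d i j le_jm) (ltD c i j le_jm); rewrite /i.
  move: (count_mem D _) (count_mem D _); lia.
rewrite leE //; case E: (count_mem D (take i (path_word d))) => [|j] //.
have le_jm : j <= m.
  rewrite -ltnS -E -[X in _ <= X.+1](size_tuple d) -count_D_path.
  by rewrite leq_count_subseq // take_subseq.
have := ltD d i j le_jm; rewrite E ltnSn ltD // => /esym.
by have := le_dc j le_jm; lia.
Qed.

End FinfOfWord.

(** * Intervals as bicolored Motzkin paths *)

Lemma closed_interval_inj (n : nat) (P Q P' Q' : Finf n) :
    (P <= Q)%O -> (P' <= Q')%O ->
  closed_interval P Q = closed_interval P' Q' -> P = P' /\ Q = Q'.
Proof.
move=> lePQ lePQ' /setP E.
(* The endpoints of each interval lie in the other one. *)
have := E P; have := E Q; have := E P'; have := E Q'.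
rewrite !inE !lexx lePQ lePQ' /= => /andP[_ Q'Q] /andP[PP' _].
move=> /esym/andP[_ QQ'] /esym/andP[P'P _].
by split; apply: le_anti; apply/andP.
Qed.

(** A step encodes one letter of each of the two words, so that its rise is the lower bit minus the
    upper bit. *)
Definition lower_bit (s : mstep) : bool :=
  match s with MU | MF1 => true | MD | MF2 => false end.
Definition upper_bit (s : mstep) : bool :=
  match s with MD | MF1 => true | MU | MF2 => false end.
Definition mstep_of_bits (p q : bool) : mstep :=
  match p, q with
  | true, true => MF1 | true, false => MU
  | false, true => MD | false, false => MF2
  end.

Lemma height_mrise (w : seq mstep) :
  height mrise w = ((count lower_bit w)%:Z - (count upper_bit w)%:Z)%R.
Proof.
elim: w => [|s w IHw]; first by rewrite /height big_nil.
by rewrite height_cons IHw; case: s => /=; lia.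
Qed.


Lemma bits_inj (w w' : seq mstep) :
  map lower_bit w = map lower_bit w' -> map upper_bit w = map upper_bit w' ->
  w = w'.
Proof.
elim: w w' => [|s w IHw] [|s' w'] //= [es /IHw{}IHw] [es' /IHw ->].
by congr (_ :: _); case: s s' es es' => [] [].
Qed.

Section MotzkinIntervals.
Variable m : nat.
Implicit Types (w : m.-tuple mstep) (c d : m.-tuple bool).

Definition lower_word w : m.-tuple bool := [tuple of rev (map lower_bit w)].
Definition upper_word w : m.-tuple bool := [tuple of rev (map upper_bit w)].

(** Because of the reversal, the first [m - k] steps of [w] carry the suffixes [drop k] of both
    words, and the height there is the difference of their counts. *)
Lemma nonneg_path_le w :
  nonneg_path mrise w =
    (Finf_of_word (lower_word w) <= Finf_of_word (upper_word w))%O.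
Proof.
have hE k : k <= m -> (0 <= height mrise (take (m - k) w))%R
    = (count id (drop k (upper_word w)) <= count id (drop k (lower_word w))).
  move=> le_km; rewrite height_mrise /= !drop_rev !count_rev !size_map.
  by rewrite size_tuple -!map_take !count_map subr_ge0.
apply/forallP/le_Finf_of_word => [pos j le_jm | le_w [i /=]].
  have lt_j : m - j < (size w).+1 by rewrite size_tuple ltnS leq_subr.
  by rewrite -hE //; apply: (pos (Ordinal lt_j)).
rewrite size_tuple ltnS => le_im.
by rewrite -(subKn le_im) hE ?leq_subr // le_w ?leq_subr.
Qed.

Lemma lower_upper_word_surj c d :
  exists w, lower_word w = c /\ upper_word w = d.
Proof.
exists [tuple of rev [seq mstep_of_bits b.1 b.2 | b <- zip c d]].
split; apply: val_inj; rewrite /= map_rev revK -map_comp.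
  by rewrite -[RHS](@unzip1_zip _ _ c d) ?size_tuple //;
    apply: eq_map => -[[] []].
by rewrite -[RHS](@unzip2_zip _ _ c d) ?size_tuple //;
    apply: eq_map => -[[] []].
Qed.

Definition interval_of_motzkin (w : bicolored_motzkin m) :
  interval_of_Finf m.+1.
Proof.
exists (closed_interval (Finf_of_word (lower_word (val w)))
                        (Finf_of_word (upper_word (val w)))).
apply/existsP; exists (Finf_of_word (lower_word (val w))).
apply/existsP; exists (Finf_of_word (upper_word (val w))).
by rewrite eqxx -nonneg_path_le (valP w).
Defined.

Lemma interval_of_motzkin_inj : injective interval_of_motzkin.
Proof.
move=> w w' /(congr1 val) /closed_interval_inj.
rewrite -!nonneg_path_le (valP w) (valP w') => /(_ isT isT)[].
move=> /Finf_of_word_inj/(congr1 val)/(can_inj revK) el.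
move=> /Finf_of_word_inj/(congr1 val)/(can_inj revK) eu.
exact/val_inj/val_inj/bits_inj.
Qed.

Lemma interval_of_motzkin_surj (I : interval_of_Finf m.+1) :
  exists w : bicolored_motzkin m, interval_of_motzkin w == I.
Proof.
case: I => I iI; have /existsP[P /existsP[Q /andP[lePQ /eqP eI]]] := iI.
have [c eP] := Finf_of_word_surj P; have [d eQ] := Finf_of_word_surj Q.
have [w [ec ed]] := lower_upper_word_surj c d.
have nw : nonneg_path mrise w by rewrite nonneg_path_le ec ed -eP -eQ.
by exists (Sub w nw); apply/eqP/val_inj; rewrite /= ec ed -eP -eQ.
Qed.

End MotzkinIntervals.

Theorem theorem4p4 (n : nat) (hn : 1 <= n) :
  exists f : interval_of_Finf n -> bicolored_motzkin n.-1, bijective f.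
Proof.
case: n hn => // m _.
(* The constructed map goes from paths to intervals; the required [f] is its inverse, obtained by
   choosing a preimage. *)
exists (fun I => xchoose (interval_of_motzkin_surj I)).
exists (@interval_of_motzkin m) => [I | w].
  exact/eqP/(xchooseP (interval_of_motzkin_surj I)).
apply: interval_of_motzkin_inj.
exact/eqP/(xchooseP (interval_of_motzkin_surj _)).
Qed.
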